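(* Let $\mathfrak Q=(\mathfrak Q,\ast,e)$ be a unitally nondistributive quantale whose underlying lattice has exactly $7$ elements. Then $\mathfrak Q$ is (up to isomorphism) the extension by an isolated unit of a quantale $P$ whose underlying lattice is either the diamond $\mathsf M_3$ or the pentagon $\mathsf N_5$ and which satisfies $(\gamma\ast\lambda)\vee(\lambda\ast\gamma)\le\lambda$ for all $\lambda\in P$. That is, the underlying lattice of $\mathfrak Q$ is $\overline P^\gamma=P\cup\{e,\overline\top\}$, where $e$ is the unit of $\mathfrak Q$, and $P$ is a subquantale of $\mathfrak Q$. Here $\gamma$ denotes the element of $\mathsf M_3$, respectively $\mathsf N_5$, specified in the context.
   Context: A quantale is a complete lattice with an associative binary operation $\ast$ preserving arbitrary joins in each variable separately; it is unital if $\ast$ has a two-sided unit. A subquantale is a subset closed under arbitrary joins and under $\ast$. Totally below relation on a complete lattice $L$: $\beta\vartriangleleft\alpha$ if for every $A\subseteq L$ with $\alpha\le\bigvee A$ there is $\gamma\in A$ with $\beta\le\gamma$. A unital quantale $(\mathfrak Q,\ast,e)$ is unitally nondistributive if (1) $\bigvee\{\alpha\in\mathfrak Q\mid\alpha\vartriangleleft e\}=e$ and (2) there is a subset $A\subseteq\mathfrak Q$ with $e\wedge(\bigvee A)\not\le\bigvee_{\alpha\in A}(e\wedge\alpha)$. The diamond $\mathsf M_3=\{\bot,\alpha,\beta,\gamma,\top\}$ has exactly the three atoms $\alpha,\beta,\gamma$, each covered by $\top$. The pentagon $\mathsf N_5=\{\bot,\alpha,\beta,\gamma,\top\}$ has covering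 relations $\bot\prec\alpha\prec\gamma\prec\top$ and $\bot\prec\beta\prec\top$. For a complete lattice $P$, $\gamma\in P$ and two distinct new elements $e,\overline\top\notin P$, the complete lattice $\overline P^\gamma=P\cup\{e,\overline\top\}$ has the order extending that of $P$ in which $\overline\top$ is the top element and, for $\lambda\in P$: $\lambda\le e$ if $\lambda\le\gamma$ in $P$, and $\lambda$ and $e$ are incomparable if $\lambda\not\le\gamma$ in $P$. *)

(* Defs.v *)
From HB Require Import structures.
From mathcomp Require Import all_boot all_order.

Set Implicit Arguments.
Unset Strict Implicit.
Unset Printing Implicit Defensive.

Import Order.TTheory.
Local Open Scope order_scope.

(* Every nonempty finite lattice is complete, the supremum of a subset A being
   \join_(x in A) x; the empty subset gives \bot. *)
Section Quantales.
Variables (d : Order.disp_t) (Q : finTBLatticeType d).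
Implicit Types (mul : Q -> Q -> Q) (e : Q) (A : {set Q}).

Record is_quantale mul : Prop := IsQuantale {
  quantale_mulA : associative mul;
  quantale_mul_joinl : forall A y,
    mul (\join_(x in A) x) y = \join_(x in A) mul x y;
  quantale_mul_joinr : forall x A,
    mul x (\join_(y in A) y) = \join_(y in A) mul x y
}.

Record is_unital_quantale mul e : Prop := IsUnitalQuantale {
  unital_quantale : is_quantale mul;
  unital_mul1l : left_id e mul;
  unital_mul1r : right_id e mul
}.

Definition is_subquantale mul (S : {set Q}) : Prop :=
  (forall A, A \subset S -> \join_(x in A) x \in S) /\
  (forall x y, x \in S -> y \in S -> mul x y \in S).

Definition totally_below (b a : Q) : bool :=
  [forall A : {set Q}, (a <= \join_(x in A) x) ==> [exists c in A, b <= c]].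

Record unitally_nondistributive mul e : Prop := UnitallyNondistributive {
  und_unital : is_unital_quantale mul e;
  und_join : \join_(a | totally_below a e) a = e;
  und_nondistr : exists A : {set Q},
    ~~ (e `&` (\join_(a in A) a) <= \join_(a in A) (e `&` a))
}.

End Quantales.

Fact M3_display : Order.disp_t. Proof. exact: Order.Disp tt tt. Qed.
Inductive M3 := M3bot | M3alpha | M3beta | M3gamma | M3top.

Definition M3_enc x : nat :=
  match x with
  | M3bot => 0 | M3alpha => 1 | M3beta => 2 | M3gamma => 3 | M3top => 4
  end.
Definition M3_dec n : option M3 :=
  nth None (map Some [:: M3bot; M3alpha; M3beta; M3gamma; M3top]) n.
Lemma M3_encK : pcancel M3_enc M3_dec. Proof. by case. Qed.

HB.instance Definition _ := Countable.copy M3 (pcan_type M3_encK).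

Lemma M3_enumP : Finite.axiom [:: M3bot; M3alpha; M3beta; M3gamma; M3top].
Proof. by case. Qed.
HB.instance Definition _ := isFinite.Build M3 M3_enumP.

Definition M3_le (x y : M3) := [|| x == y, x == M3bot | y == M3top].
Definition M3_meet x y := if M3_le x y then x else if M3_le y x then y else M3bot.
Definition M3_join x y := if M3_le x y then y else if M3_le y x then x else M3top.

Lemma M3_le_refl : reflexive M3_le. Proof. by case. Qed.
Lemma M3_le_anti : antisymmetric M3_le. Proof. by case; case. Qed.
Lemma M3_le_trans : transitive M3_le. Proof. by case; case; case. Qed.
Lemma M3_meetP x y z : M3_le x (M3_meet y z) = M3_le x y && M3_le x z.
Proof. by case: x; case: y; case: z. Qed.
Lemma M3_joinP x y z : M3_le (M3_join x y) z = M3_le x z && M3_le y z.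
Proof. by case: x; case: y; case: z. Qed.
Lemma M3_le0x x : M3_le M3bot x. Proof. by case: x. Qed.
Lemma M3_lex1 x : M3_le x M3top. Proof. by case: x. Qed.

HB.instance Definition _ :=
  Order.Le_isPOrder.Build M3_display M3 M3_le_refl M3_le_anti M3_le_trans.
HB.instance Definition _ :=
  Order.POrder_MeetJoin_isLattice.Build M3_display M3 M3_meetP M3_joinP.
HB.instance Definition _ :=
  Order.hasBottom.Build M3_display M3 M3_le0x.
HB.instance Definition _ :=
  Order.hasTop.Build M3_display M3 M3_lex1.

Fact N5_display : Order.disp_t. Proof. exact: Order.Disp tt tt. Qed.
Inductive N5 := N5bot | N5alpha | N5beta | N5gamma | N5top.

Definition N5_enc x : nat :=
  match x with
  | N5bot => 0 | N5alpha => 1 | N5beta => 2 | N5gamma => 3 | N5top => 4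
  end.
Definition N5_dec n : option N5 :=
  nth None (map Some [:: N5bot; N5alpha; N5beta; N5gamma; N5top]) n.
Lemma N5_encK : pcancel N5_enc N5_dec. Proof. by case. Qed.

HB.instance Definition _ := Countable.copy N5 (pcan_type N5_encK).

Lemma N5_enumP : Finite.axiom [:: N5bot; N5alpha; N5beta; N5gamma; N5top].
Proof. by case. Qed.
HB.instance Definition _ := isFinite.Build N5 N5_enumP.

Definition N5_le (x y : N5) :=
  [|| x == y, x == N5bot, y == N5top | (x == N5alpha) && (y == N5gamma)].
Definition N5_meet x y := if N5_le x y then x else if N5_le y x then y else N5bot.
Definition N5_join x y := if N5_le x y then y else if N5_le y x then x else N5top.

Lemma N5_le_refl : reflexive N5_le. Proof. by case. Qed.
Lemma N5_le_anti : antisymmetric N5_le. Proof. by case; case. Qed.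
Lemma N5_le_trans : transitive N5_le. Proof. by case; case; case. Qed.
Lemma N5_meetP x y z : N5_le x (N5_meet y z) = N5_le x y && N5_le x z.
Proof. by case: x; case: y; case: z. Qed.
Lemma N5_joinP x y z : N5_le (N5_join x y) z = N5_le x z && N5_le y z.
Proof. by case: x; case: y; case: z. Qed.
Lemma N5_le0x x : N5_le N5bot x. Proof. by case: x. Qed.
Lemma N5_lex1 x : N5_le x N5top. Proof. by case: x. Qed.

HB.instance Definition _ :=
  Order.Le_isPOrder.Build N5_display N5 N5_le_refl N5_le_anti N5_le_trans.
HB.instance Definition _ :=
  Order.POrder_MeetJoin_isLattice.Build N5_display N5 N5_meetP N5_joinP.
HB.instance Definition _ :=
  Order.hasBottom.Build N5_display N5 N5_le0x.
HB.instance Definition _ :=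
  Order.hasTop.Build N5_display N5 N5_lex1.

(* The carrier P + {e, new top}; the parameter g does not occur in the
   constructors and only selects the order below. *)
Inductive isolated_ext (d : Order.disp_t) (P : tbLatticeType d) (g : P) :=
  ExtBase of P | ExtUnit | ExtTop.

Arguments ExtBase {d P} g _.
Arguments ExtUnit {d P} g.
Arguments ExtTop {d P} g.

Section IsolatedExt.
Variables (d : Order.disp_t) (P : tbLatticeType d) (g : P).
Local Notation E := (isolated_ext g).

Definition iext_enc (x : E) : P + bool :=
  match x with ExtBase p => inl p | ExtUnit => inr true | ExtTop => inr false end.
Definition iext_dec (x : P + bool) : E :=
  match x with
  | inl p => ExtBase g p | inr b => if b then ExtUnit g else ExtTop g
  end.
Lemma iext_encK : cancel iext_enc iext_dec. Proof. by case. Qed.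

HB.instance Definition _ := Choice.copy E (can_type iext_encK).

Definition iext_le (x y : E) : bool :=
  match x, y with
  | _, ExtTop => true
  | ExtTop, _ => false
  | ExtBase p, ExtBase q => p <= q
  | ExtBase p, ExtUnit => p <= g
  | ExtUnit, ExtBase _ => false
  | ExtUnit, ExtUnit => true
  end.

Definition iext_meet (x y : E) : E :=
  match x, y with
  | x, ExtTop => x
  | ExtTop, y => y
  | ExtBase p, ExtBase q => ExtBase g (p `&` q)
  | ExtBase p, ExtUnit | ExtUnit, ExtBase p => ExtBase g (p `&` g)
  | ExtUnit, ExtUnit => ExtUnit g
  end.

Definition iext_join (x y : E) : E :=
  match x, y with
  | _, ExtTop | ExtTop, _ => ExtTop g
  | ExtBase p, ExtBase q => ExtBase g (p `|` q)
  | ExtBase p, ExtUnit | ExtUnit, ExtBase p =>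
      if p <= g then ExtUnit g else ExtTop g
  | ExtUnit, ExtUnit => ExtUnit g
  end.

Lemma iext_le_refl : reflexive iext_le. Proof. by case=> //= p; exact: lexx. Qed.

Lemma iext_le_anti : antisymmetric iext_le.
Proof. by case=> [p||] [q||] //=; rewrite ?andbF // => /le_anti ->. Qed.

Lemma iext_le_trans : transitive iext_le.
Proof. by case=> [p||] [q||] [r||] //=; exact: le_trans. Qed.

Lemma iext_meetP x y z : iext_le x (iext_meet y z) = iext_le x y && iext_le x z.
Proof.
by case: x y z => [p||] [q||] [r||]; rewrite /= ?lexI ?andbT ?andbb // andbC.
Qed.

Lemma iext_joinP x y z : iext_le (iext_join x y) z = iext_le x z && iext_le y z.
Proof.
case: x y z => [p||] [q||] [r||]; rewrite /= ?leUx ?andbT ?andbF ?andbb //.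
all: by case: ifP.
Qed.

Lemma iext_le0x x : iext_le (ExtBase g \bot) x.
Proof. by case: x => [p||] //=; exact: le0x. Qed.
Lemma iext_lex1 x : iext_le x (ExtTop g). Proof. by case: x. Qed.

HB.instance Definition _ :=
  Order.Le_isPOrder.Build d E iext_le_refl iext_le_anti iext_le_trans.
HB.instance Definition _ :=
  Order.POrder_MeetJoin_isLattice.Build d E iext_meetP iext_joinP.
HB.instance Definition _ := Order.hasBottom.Build d E iext_le0x.
HB.instance Definition _ := Order.hasTop.Build d E iext_lex1.

End IsolatedExt.

HB.instance Definition _ d (P : finTBLatticeType d) (g : P) :=
  Finite.copy (isolated_ext g) (can_type (@iext_encK d P g)).

(* Up to the isomorphism f, the underlying lattice of (Q, mul, e) is the lattice
   isolated_ext g, the added element ExtUnit is the unit e, and (P, mulP) is a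
   subquantale.  An order isomorphism preserves all joins and meets. *)
Definition is_isolated_unit_extension
    (dP : Order.disp_t) (P : finTBLatticeType dP) (g : P) (mulP : P -> P -> P)
    (d : Order.disp_t) (Q : finTBLatticeType d) (mul : Q -> Q -> Q) (e : Q) :=
  exists f : isolated_ext g -> Q,
    [/\ bijective f,
        {mono f : x y / x <= y},
        f (ExtUnit g) = e,
        (forall p q, f (ExtBase g (mulP p q)) =
                     mul (f (ExtBase g p)) (f (ExtBase g q)))
      & is_subquantale mul [set f (ExtBase g p) | p : P]].

(* Main.v *)
(** As [e] is the join of the elements totally below it, [e <= \join_(a in A) a]
    implies [e <= \join_(a in A) (e `&` a)].  Hence if [e] fails to distribute over
    [w = u `|` v], then [w] is not above [e], and [\top], [w], [v], [e],
    [x = e `&` w] and [y = (e `&` u) `|` (e `&` v)] are six distinct elements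
    (after exchanging [u] and [v] so that [v] is not below [e]).  Having only seven
    elements forces [y = \bot] (then [\bot, u, v, x, w] is a diamond) or [u = y]
    (then it is a pentagon), and in both cases [e] and [\top] are the only elements
    not below [w].

    It remains to see that [w * w <= w].  Write [c] for [x], and [b] for [v], an
    atom of the ideal generated by [w] with [w = c `|` b].  As [c <= e], the only
    term of [w * w = (c `|` b) * (c `|` b)] which might not be below [w] is [b * b].
    If it is not, then [e <= b * b], hence [c <= c * b * b], so [c * b] is a nonzero
    element below the atom [b]; thus [c * b = b] and
    [b * b = c * b * b <= c * \top = c * (e `|` w) <= w]. *)
Require Import Defs.
From mathcomp Require Import all_boot all_order.

Set Implicit Arguments.
Unset Strict Implicit.
Unset Printing Implicit Defensive.

Import Order.TTheory.
Local Open Scope order_scope.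

(** * Binary joins and monotonicity of the multiplication *)

Lemma join_set2 (dL : Order.disp_t) (L : finTBLatticeType dL) (T : finType)
    (F : T -> L) (a b : T) :
  \join_(x in [set a; b]) F x = F a `|` F b.
Proof.
have [->|nab] := eqVneq a b; first by rewrite setUid big_set1 joinxx.
by rewrite big_setU1 ?inE //= big_set1.
Qed.

Section QuantaleTheory.
Context {d : Order.disp_t} {Q : finTBLatticeType d} {mul : Q -> Q -> Q}.
Hypothesis mulQ : is_quantale mul.

Lemma quantale_mulUl (x y z : Q) : mul (x `|` y) z = mul x z `|` mul y z.
Proof. by have := quantale_mul_joinl mulQ [set x; y] z; rewrite !join_set2. Qed.

Lemma quantale_mulUr (x y z : Q) : mul x (y `|` z) = mul x y `|` mul x z.
Proof. by have := quantale_mul_joinr mulQ x [set y; z]; rewrite !join_set2. Qed.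

Lemma quantale_mul0x (x : Q) : mul \bot x = \bot.
Proof. by have := quantale_mul_joinl mulQ set0 x; rewrite !big_set0. Qed.

Lemma quantale_leM (x x' y y' : Q) :
  x <= x' -> y <= y' -> mul x y <= mul x' y'.
Proof.
move=> /join_idPl xx' /join_idPl yy'.
by rewrite -xx' -yy' quantale_mulUl !quantale_mulUr !joinA leUr.
Qed.

End QuantaleTheory.

(** * Embedded lattices that miss only the unit and the top *)

Section Embedding.
Context {dP : Order.disp_t} {P : finTBLatticeType dP} {g b : P}.
Context {d : Order.disp_t} {Q : finTBLatticeType d}.
Context {mul : Q -> Q -> Q} {e : Q} {h : P -> Q}.
Hypothesis unitalQ : is_unital_quantale mul e.
Hypothesis cardQ : #|Q| = #|P| + 2.
Hypothesis h_mono : {mono h : x y / x <= y}.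
Hypothesis h_le_e : forall p, (h p <= e) = (p <= g).
Hypothesis e_nle_h : forall p, ~~ (e <= h p).
(** The diamond and the pentagon are treated alike through [b], an atom whose join with [g] is the
    top of [P]. *)
Hypotheses (g_neq0 : g != \bot) (g_neq1 : g != \top) (gUb : g `|` b = \top).
Hypothesis b_atom : forall p, p <= b -> p = \bot \/ p = b.

Let w := h \top.
Let mulQ := unital_quantale unitalQ.
Let mul1 := unital_mul1l unitalQ.
Let mulx1 := unital_mul1r unitalQ.

Definition ext_map (x : isolated_ext g) : Q :=
  match x with ExtBase p => h p | ExtUnit => e | ExtTop => \top end.

Lemma ext_map_mono : {mono ext_map : x y / x <= y}.
Proof.
have top_nle_e : (\top <= e) = false.
  apply: contraNF g_neq1 => le1e.
  by rewrite -le1x -h_le_e (le_trans (lex1 _) le1e).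
have top_nle_h p : (\top <= h p) = false.
  by apply: contraNF (e_nle_h p) => /(le_trans (lex1 e)).
case=> [p||] [q||] //=; rewrite ?lex1 ?lexx ?h_mono ?h_le_e //.
exact: negbTE.
Qed.

(** An order embedding is injective, so counting suffices: [iext_dec] injects [P + bool], which has
    [#|P| + 2] elements, into the extension. *)
Lemma ext_map_bij : bijective ext_map.
Proof.
apply: inj_card_bij (inc_inj ext_map_mono) _.
have dec_inj : injective (@iext_dec _ P g).
  by apply: (can_inj (g := @iext_enc _ P g)) => -[//|[]].
by rewrite cardQ -card_bool -card_sum (leq_card _ dec_inj).
Qed.

Lemma ext_map_cases (q : Q) :
  [\/ exists p, q = h p, q = e | q = \top].
Proof.
have [k _ kK] := ext_map_bij; rewrite -(kK q).
by case: (k q) => [p||] /=; [apply: Or31; exists p | apply: Or32 | apply: Or33].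
Qed.

(** The only elements that may lie outside the image of [h] are [e] and [\top], and neither is below
    [w]. *)
Lemma le_wP (q : Q) : reflect (exists p, q = h p) (q <= w).
Proof.
apply: (iffP idP) => [|[p ->]]; last by rewrite h_mono lex1.
case: (ext_map_cases q) => // -> le_w; first by have := e_nle_h \top; rewrite le_w.
by have := e_nle_h \top; rewrite (le_trans (lex1 e) le_w).
Qed.

Lemma le_w_or_ge_e (q : Q) : (q <= w) || (e <= q).
Proof.
by case: (ext_map_cases q) => [[p ->]|->|->]; rewrite ?h_mono ?lex1 ?lexx ?orbT.
Qed.

Lemma top_eq_joinew : e `|` w = \top.
Proof.
case: (ext_map_cases (e `|` w)) => // [[p]|] E.
  by have := e_nle_h p; rewrite -E leUl.
have : w <= e by rewrite -E leUr.
by rewrite h_le_e le1x (negbTE g_neq1).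
Qed.

(** The join taken in [Q] stays below [w], hence has a preimage [r]; this [r] bounds all [F i] in
    [P]. *)
Lemma h_join (I : finType) (A : {set I}) (F : I -> P) :
  h (\join_(i in A) F i) = \join_(i in A) h (F i).
Proof.
apply/le_anti/andP; split; last first.
  by apply/joinsP => i iA; rewrite h_mono; exact: joins_sup.
have [|r Er] := le_wP (\join_(i in A) h (F i)) _.
  by apply/joinsP => i _; rewrite h_mono lex1.
rewrite Er h_mono; apply/joinsP => i iA.
by rewrite -h_mono -Er; exact: (joins_sup (fun i => h (F i))).
Qed.

Lemma h_join2 (p q : P) : h (p `|` q) = h p `|` h q.
Proof.
have := h_join [set true; false] (fun c => if c then p else q).
by rewrite !join_set2.
Qed.

Lemma h_bot : h \bot = \bot.
Proof. by have := h_join set0 (fun p : P => p); rewrite !big_set0. Qed.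

Lemma mul_gl (q : Q) : mul (h g) q <= q.
Proof. by rewrite -[leRHS]mul1 (quantale_leM mulQ) // h_le_e. Qed.

Lemma mul_gr (q : Q) : mul q (h g) <= q.
Proof. by rewrite -[leRHS]mulx1 (quantale_leM mulQ) // h_le_e. Qed.

Lemma mul_g_le_w (q : Q) : mul (h g) q <= w.
Proof.
apply: (@le_trans _ _ (mul (h g) \top)); first by rewrite (quantale_leM mulQ) ?lex1.
by rewrite -top_eq_joinew (quantale_mulUr mulQ) mulx1 leUx mul_gl h_mono lex1.
Qed.

Lemma mul_bb_le_w : mul (h b) (h b) <= w.
Proof.
case/orP: (le_w_or_ge_e (mul (h b) (h b))) => // ebb.
have /le_wP[p Ep] := mul_g_le_w (h b).
have lepb : p <= b by rewrite -h_mono -Ep mul_gl.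
have gbb : mul (h g) (mul (h b) (h b)) = mul (h p) (h b).
  by rewrite (quantale_mulA mulQ) Ep.
(* For [p = b], [gbb] shows that the square of [h b] is a left multiple of [h g]. For [p = \bot], it
   would force [h g <= \bot]. *)
case: (b_atom lepb) => E; rewrite {}E in gbb; last by rewrite -gbb mul_g_le_w.
have : mul (h g) e <= mul (h g) (mul (h b) (h b)) by rewrite (quantale_leM mulQ).
by rewrite gbb h_bot (quantale_mul0x mulQ) mulx1 -h_bot h_mono lex0 (negbTE g_neq0).
Qed.

Lemma mul_le_w (x y : Q) : x <= w -> y <= w -> mul x y <= w.
Proof.
move=> xw yw; apply: le_trans (quantale_leM mulQ xw yw) _.
rewrite {1}/w -gUb h_join2 (quantale_mulUl mulQ) leUx mul_g_le_w /=.
(* Unfolding [w] also splits the bound on the right; the second [h_join2] and [gUb] restore it. *)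
rewrite /w -gUb h_join2 (quantale_mulUr mulQ) -h_join2 gUb leUx mul_bb_le_w andbT.
by rewrite (le_trans (mul_gr _)) // h_mono lex1.
Qed.

Lemma embedding_isolated_unit_extension :
  exists mulP : P -> P -> P,
    [/\ is_quantale mulP,
        forall l, mulP g l `|` mulP l g <= l
      & is_isolated_unit_extension g mulP mul e].
Proof.
have h_inj := inc_inj h_mono.
(* The product is pulled back along [h]. The default [\bot] is never reached, since [mul_le_w] and
   [le_wP] provide a preimage. *)
pose mulP p q := odflt \bot [pick r | h r == mul (h p) (h q)].
have hM p q : h (mulP p q) = mul (h p) (h q).
  rewrite /mulP; case: pickP => [r /eqP //|none].
  have /le_wP[r Er] : mul (h p) (h q) <= w by rewrite mul_le_w ?h_mono ?lex1.
  by have := none r; rewrite Er eqxx.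
(* The quantale laws of [mul] concern joins over subsets of [Q], so joins over [A] are moved to
   [h @: A]. *)
have him (A : {set P}) (F : Q -> Q) :
    \join_(z in h @: A) F z = \join_(p in A) F (h p).
  by rewrite big_imset //; exact: in2W.
exists mulP; split.
- split.
  + by move=> p q r; apply: h_inj; rewrite !hM (quantale_mulA mulQ).
  + move=> A y; apply: h_inj; rewrite hM !h_join -(him A id).
    rewrite (quantale_mul_joinl mulQ) him.
    by apply: eq_bigr => x _; rewrite hM.
  + move=> x A; apply: h_inj; rewrite hM !h_join -(him A id).
    rewrite (quantale_mul_joinr mulQ) him.
    by apply: eq_bigr => y _; rewrite hM.
- by move=> l; rewrite leUx -!h_mono !hM mul_gl mul_gr.
exists ext_map; split => //; [exact: ext_map_bij | exact: ext_map_mono |].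
have memS q : (q \in [set h p | p : P]) = (q <= w).
  by apply/imsetP/le_wP => [[p _ ->]|[p ->]]; exists p.
split=> [A /subsetP AS|x y]; rewrite !memS; last exact: mul_le_w.
by apply/joinsP => x /AS; rewrite memS.
Qed.

End Embedding.

(** * Finding the diamond or the pentagon among seven elements *)

Lemma card_M3 : #|{: M3}| = 5.
Proof. by rewrite cardE enumT unlock. Qed.

Lemma card_N5 : #|{: N5}| = 5.
Proof. by rewrite cardE enumT unlock. Qed.

(** All joins are finite, so binary distributivity at [e] would extend to them by induction, the
    empty join being [meetx0]. *)
Lemma nondistr_binary (d : Order.disp_t) (Q : finTBLatticeType d) (e : Q)
    (A : {set Q}) :
  ~~ (e `&` (\join_(a in A) a) <= \join_(a in A) (e `&` a)) ->
  exists u v : Q, ~~ (e `&` (u `|` v) <= (e `&` u) `|` (e `&` v)).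
Proof.
move=> nd; have [/forallP dist|] := boolP
  [forall u, forall v, e `&` (u `|` v) <= (e `&` u) `|` (e `&` v)]; last first.
  by case/forallPn => u /forallPn[v] uv; exists u, v.
case/negP: nd; apply: (big_rec2 (fun x y => e `&` x <= y)).
  by rewrite meetx0.
move=> a x y _ le_xy.
apply: le_trans (forallP (dist a) _) _.
by rewrite leUx leUl (le_trans le_xy) ?leUr.
Qed.

Theorem corollary4p3 (d : Order.disp_t) (Q : finTBLatticeType d)
    (mul : Q -> Q -> Q) (e : Q) :
  unitally_nondistributive mul e -> #|Q| = 7 ->
  (exists mulP : M3 -> M3 -> M3,
     [/\ is_quantale mulP,
         forall l : M3, mulP M3gamma l `|` mulP l M3gamma <= l
       & is_isolated_unit_extension M3gamma mulP mul e]) \/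
  (exists mulP : N5 -> N5 -> N5,
     [/\ is_quantale mulP,
         forall l : N5, mulP N5gamma l `|` mulP l N5gamma <= l
       & is_isolated_unit_extension N5gamma mulP mul e]).
Proof.
case=> unitalQ und_e [A ndA] cardQ.
have {A ndA} [u [v [nd nve]]] : exists u v,
    ~~ (e `&` (u `|` v) <= (e `&` u) `|` (e `&` v)) /\ ~~ (v <= e).
  have [u [v nd]] := nondistr_binary ndA.
  have [ve|] := boolP (v <= e); last by exists u, v.
  (* With both [u] and [v] below [e], the right-hand side of [nd] is their join and the inequality
     holds. *)
  have [ue|nue] := boolP (u <= e).
    by case/negP: nd; rewrite (meet_idPr ue) (meet_idPr ve) leIr.
  by exists v, u; rewrite joinC [X in _ <= X]joinC.
set w := u `|` v in nd; set x := e `&` w in nd.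
set y := (e `&` u) `|` (e `&` v) in nd.
have uw : u <= w := leUl _ _.
have vw : v <= w := leUr _ _.
have xe : x <= e := leIl _ _.
have xw : x <= w := leIr _ _.
have yx : y <= x by rewrite /y leUx !leI2.
have nxu : ~~ (x <= u).
  by apply: contra nd => xu; rewrite /y lexU2 // !lexI xe xu.
have nxv : ~~ (x <= v).
  by apply: contra nd => xv; rewrite /y lexU2 // !lexI xe xv orbT.
have nuv : ~~ (u <= v).
  by apply: contra nxv => uv; rewrite (le_trans xw) // /w leUx uv lexx.
have nvu : ~~ (v <= u).
  by apply: contra nxu => vu; rewrite (le_trans xw) // /w leUx vu lexx.
(* If [e <= w], every [a] totally below [e] lies below [u] or [v], hence below [y]; by [und_e] this
   gives [e <= y]. *)
have new : ~~ (e <= w).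
  apply: contra nd => ew; apply: le_trans xe _; rewrite -{1}und_e.
  apply/joinsP => a a_below_e.
  have ae : a <= e by rewrite -[leRHS]und_e; exact: joins_sup.
  have /forallP/(_ [set u; v]) := a_below_e.
  rewrite join_set2 ew => /existsP[c /andP[/set2P Ec ac]].
  by case: Ec ac => -> ac; rewrite /y lexU2 // !lexI ae ac ?orbT.
have nwe : ~~ (w <= e) by apply: contra nve; exact: le_trans.
have nvx : ~~ (v <= x) by apply: contra nve => /le_trans; apply.
have nwx : ~~ (w <= x) by apply: contra nwe => /le_trans; apply.
have neu : ~~ (e <= u) by apply: contra new => /le_trans; apply.
have nwu : ~~ (w <= u) by apply: contra nvu; exact: le_trans.
have nwv : ~~ (w <= v) by apply: contra nuv; exact: le_trans.
have u_neq0 : u != \bot by apply: contraNneq nuv => ->; exact: le0x.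
have v_neq0 : v != \bot by apply: contraNneq nvu => ->; exact: le0x.
have w_neq0 : w != \bot by apply: contraNneq nwu => ->; exact: le0x.
have e_neq0 : e != \bot by apply: contraNneq new => ->; exact: le0x.
have ue_y : u <= e -> u <= y by move=> ue; rewrite /y lexU2 // lexI ue lexx.
have nex : ~~ (e <= x) by apply: contra new => /le_trans; apply.
have nev : ~~ (e <= v) by apply: contra new => /le_trans; apply.
have x_neq0 : x != \bot by apply: contraNneq nd => ->; exact: le0x.
have [y0|y_neq0] := eqVneq y \bot.
  left; pose h p := match p with
    M3bot => \bot | M3alpha => u | M3beta => v | M3gamma => x | M3top => w end.
  (* This is where [y = \bot] enters: it keeps [u] away from [e], and so from [x]. *)
  have nue : ~~ (u <= e) by apply: contra u_neq0 => /ue_y; rewrite y0 lex0.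
  have nux : ~~ (u <= x) by apply: contra nue => /le_trans; apply.
  apply: (@embedding_isolated_unit_extension _ _ M3gamma M3beta _ _ _ _ h) => //.
  - by rewrite cardQ card_M3.
  - case; case=> /=; rewrite ?lexx ?le0x ?lex0 //; exact: negbTE.
  - case=> /=; rewrite ?le0x ?xe //; exact: negbTE.
  - by case=> //=; rewrite lex0.
  - by case=> //; [left|right].
right.
have [uy|u_neq_y] := eqVneq u y; last first.
  (* Otherwise eight elements are distinct. Most pairs are separated by a failed comparison, needed
     in both orientations. *)
  have nle_neq (a b : Q) : ~~ (a <= b) -> (a != b) * (b != a).
    by move=> ab; split; apply: contraNneq ab => ->.
  have nvy : ~~ (v <= y) by apply: contra nvx => /le_trans; apply.
  have nwy : ~~ (w <= y) by apply: contra nwx => /le_trans; apply.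
  have ney : ~~ (e <= y) by apply: contra nex => /le_trans; apply.
  have n1 z : ~~ (e <= z) -> ~~ (\top <= z).
    by apply: contra; exact: (le_trans (lex1 e)).
  have n1e : ~~ (\top <= e) by apply: contra nwe; exact: (le_trans (lex1 w)).
  have top_neq0 : \top != \bot :> Q by apply: contraNneq n1e => ->; exact: le0x.
  have : uniq [:: \bot; \top; w; v; e; x; y; u].
    rewrite /= !inE !negb_or !(eq_sym \bot).
    rewrite top_neq0 w_neq0 v_neq0 e_neq0 x_neq0 y_neq0 u_neq0.
    rewrite !(nle_neq _ _ n1e) !(nle_neq _ _ (n1 _ new)) !(nle_neq _ _ (n1 _ nev)).
    rewrite !(nle_neq _ _ (n1 _ nex)) !(nle_neq _ _ (n1 _ ney)).
    rewrite !(nle_neq _ _ (n1 _ neu)).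
    rewrite !(nle_neq _ _ nwu) !(nle_neq _ _ nwv) !(nle_neq _ _ nwe).
    rewrite !(nle_neq _ _ nwx) !(nle_neq _ _ nwy).
    rewrite !(nle_neq _ _ nve) !(nle_neq _ _ nvx) !(nle_neq _ _ nvy).
    rewrite !(nle_neq _ _ nvu) !(nle_neq _ _ nex) !(nle_neq _ _ ney).
    by rewrite !(nle_neq _ _ neu) !(nle_neq _ _ nd) !(nle_neq _ _ nxu)
       eq_sym u_neq_y.
  move=> /card_uniqP E.
  by have := max_card [in [:: \bot; \top; w; v; e; x; y; u]]; rewrite E cardQ.
(* The chain [u < x] becomes [N5alpha < N5gamma], strict by [nxu]. *)
have ux : u <= x by rewrite uy.
have ue : u <= e by exact: le_trans xe.
pose h p := match p with
  N5bot => \bot | N5alpha => u | N5beta => v | N5gamma => x | N5top => w end.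
apply: (@embedding_isolated_unit_extension _ _ N5gamma N5beta _ _ _ _ h) => //.
- by rewrite cardQ card_N5.
- case; case=> /=; rewrite ?lexx ?le0x ?lex0 //; exact: negbTE.
- case=> /=; rewrite ?le0x ?xe ?ue //; exact: negbTE.
- by case=> //=; rewrite lex0.
- by case=> //; [left|right].
Qed.
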